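(* Let $K:\mathcal X\to\mathcal Y$ be a compact linear operator with infinite dimensional range, and let $\{\alpha_n\}_{n\in\mathbb N},\{\gamma_n\}_{n\in\mathbb N}$ be sequences of real numbers with $\alpha_n>0$ and $\gamma_n\ge1/2$ for every $n$. The nonstationary iterated fractional Tikhonov (NSIFT) method converges, i.e. for every attainable $y$ the iterates $x_{\alpha_n,\gamma_n}^n$ converge to $x^\dagger=K^\dagger y$ in $\mathcal X$ as $n\to\infty$, if and only if $$\sum_n\Big(\frac{\sigma^2}{\sigma^2+\alpha_n}\Big)^{\gamma_n}$$ diverges for every $\sigma>0$.
   Context: $\mathcal X,\mathcal Y$ are Hilbert spaces; $y$ attainable means $y\in R(K)$, the range of $K$; $K^\dagger$ is the Moore-Penrose generalized inverse. $(\sigma_m;v_m,u_m)_{m\in\mathbb N}$ is the singular value expansion of $K$ ($Kv_m=\sigma_mu_m$, $K^*u_m=\sigma_mv_m$, $\sigma_m>0$ decreasing to $0$). NSIFT: $x_{\alpha_0,\gamma_0}^0=0$ and, for $n\ge1$, $$(K^*K+\alpha_nI)^{\gamma_n}x_{\alpha_n,\gamma_n}^n=(K^*K)^{\gamma_n-1}K^*y+\big[(K^*K+\alpha_nI)^{\gamma_n}-(K^*K)^{\gamma_n}\big]x_{\alpha_{n-1},\gamma_{n-1}}^{n-1},$$ where $(K^*K)^{\gamma-1}K^*y:=\sum_m\sigma_m^{2\gamma-1}\langle y,u_m\rangle v_m$. *)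

(* Defs.v *)
From mathcomp Require Import all_boot all_order all_algebra.
From mathcomp Require Import all_classical all_reals all_analysis.
From mathcomp Require Import complex.

Set Implicit Arguments.
Unset Strict Implicit.
Unset Printing Implicit Defensive.

Import Order.TTheory GRing.Theory Num.Theory.
Import numFieldNormedType.Exports.

Local Open Scope classical_set_scope.
Local Open Scope ring_scope.

(* Hilbert spaces may be real or complex. *)
Variant scalar_kind := RealScalars | ComplexScalars.

Definition scalar_field (R : realType) (k : scalar_kind) : numFieldType :=
  match k with
  | RealScalars => R
  | ComplexScalars => R[i]
  end.

Definition of_real (R : realType) (k : scalar_kind) : R -> scalar_field R k :=
  match k return R -> scalar_field R k with
  | RealScalars => fun r => r
  | ComplexScalars => fun r => (r%:C)%C
  end.
Arguments of_real {R k} r.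

Definition conj_scalar (R : realType) (k : scalar_kind) :
    scalar_field R k -> scalar_field R k :=
  match k return scalar_field R k -> scalar_field R k with
  | RealScalars => fun a => a
  | ComplexScalars => fun a => (a^*)%C
  end.
Arguments conj_scalar {R k} a.

(* The norm of a [normedModType F] takes its values in [F], so [inner_norm] is
   an equation in [F]; it makes the form positive definite. *)
Record hilbertType (R : realType) (k : scalar_kind) := HilbertType {
  hilbert_sort :> completeNormedModType (scalar_field R k);
  inner : hilbert_sort -> hilbert_sort -> scalar_field R k;
  inner_linear_l : forall (a : scalar_field R k) (x y z : hilbert_sort),
    inner (a *: x + y) z = a * inner x z + inner y z;
  inner_conj : forall x y : hilbert_sort, inner y x = conj_scalar (inner x y);
  inner_norm : forall x : hilbert_sort, inner x x = `|x| ^+ 2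
}.
Arguments inner {R k h} _ _.

Definition orthonormal_seq (R : realType) (k : scalar_kind) (H : hilbertType R k)
    (e : nat -> H) : Prop :=
  forall i j : nat, inner (e i) (e j) = (i == j)%:R.

Definition compact_operator (R : realType) (k : scalar_kind)
    (X Y : hilbertType R k) (K : {linear X -> Y}) : Prop :=
  forall A : set X, bounded_set A -> precompact (K @` A).

Definition infinite_dim_range (R : realType) (k : scalar_kind)
    (X Y : hilbertType R k) (K : {linear X -> Y}) : Prop :=
  ~ exists (n : nat) (e : 'I_n -> Y), forall y : Y, range K y ->
      exists c : 'I_n -> scalar_field R k, y = \sum_(i < n) c i *: e i.

(* For a bounded K the adjoint at y exists (Riesz) and is unique, so the
   default value 0 of [xget] is not used. *)
Definition adjoint (R : realType) (k : scalar_kind)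
    (X Y : hilbertType R k) (K : {linear X -> Y}) (y : Y) : X :=
  xget 0 [set z : X | forall x : X, inner (K x) y = inner x z].

(* K^dagger is the linear extension of the inverse of K : N(K)^perp -> R(K) to
   D(K^dagger) = R(K) + R(K)^perp that vanishes on R(K)^perp: its value at
   y = K x + w, with x in N(K)^perp and w in R(K)^perp, is x.  The value 0 is
   used outside D(K^dagger). *)
Definition pinv (R : realType) (k : scalar_kind)
    (X Y : hilbertType R k) (K : {linear X -> Y}) (y : Y) : X :=
  xget 0 [set x : X | (forall z : X, K z = 0 -> inner x z = 0) /\
                      (forall z : X, inner (y - K x) (K z) = 0)].

(* Singular values are listed with multiplicity, hence only nonincreasing.
   [sve_expansion] says that the system is complete in N(K)^perp. *)
Record is_sve (R : realType) (k : scalar_kind) (X Y : hilbertType R k)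
    (K : {linear X -> Y}) (sigma : nat -> R) (v : nat -> X) (u : nat -> Y) :
    Prop := IsSve {
  sve_gt0 : forall m, 0 < sigma m;
  sve_nonincreasing : forall m n, (m <= n)%N -> sigma n <= sigma m;
  sve_cvg0 : sigma m @[m --> \oo] --> (0 : R);
  sve_orthonormal_r : orthonormal_seq v;
  sve_orthonormal_l : orthonormal_seq u;
  sve_apply : forall m, K (v m) = of_real (sigma m) *: u m;
  sve_adjoint : forall m, adjoint K (u m) = of_real (sigma m) *: v m;
  sve_expansion : forall x : X,
    series (fun m => (of_real (sigma m) * inner x (v m)) *: u m) n @[n --> \oo]
      --> K x
}.

Definition proj_v (R : realType) (k : scalar_kind) (X : hilbertType R k)
    (v : nat -> X) (x : X) : X :=
  limn (series (fun m => inner x (v m) *: v m)).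

(* f(K^*K) x, where K^*K has the eigenvectors v m for the eigenvalues
   (sigma m)^2 and N(K) as eigenspace for 0; x - proj_v v x is the component of
   x in N(K). *)
Definition fun_calc (R : realType) (k : scalar_kind) (X : hilbertType R k)
    (sigma : nat -> R) (v : nat -> X) (f : R -> R) (x : X) : X :=
  limn (series (fun m => (of_real (f (sigma m ^+ 2)) * inner x (v m)) *: v m))
  + of_real (f 0) *: (x - proj_v v x).

(* (K^*K)^g x *)
Definition normal_pow (R : realType) (k : scalar_kind) (X : hilbertType R k)
    (sigma : nat -> R) (v : nat -> X) (g : R) (x : X) : X :=
  fun_calc sigma v (fun t => t `^ g) x.

(* (K^*K + a I)^g x *)
Definition shifted_pow (R : realType) (k : scalar_kind) (X : hilbertType R k)
    (sigma : nat -> R) (v : nat -> X) (a g : R) (x : X) : X :=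
  fun_calc sigma v (fun t => (t + a) `^ g) x.

(* (K^*K)^(g-1) K^* y *)
Definition normal_pow_adjoint (R : realType) (k : scalar_kind)
    (X Y : hilbertType R k) (sigma : nat -> R) (v : nat -> X) (u : nat -> Y)
    (g : R) (y : Y) : X :=
  limn (series
    (fun m => (of_real (sigma m `^ (2 * g - 1)) * inner y (u m)) *: v m)).

(* The operator (K^*K + a I)^g is bijective for a > 0, so the default value 0 of
   [xget] is not used.  The parameters alpha 0 and gamma 0 play no role. *)
Fixpoint nsift (R : realType) (k : scalar_kind) (X Y : hilbertType R k)
    (sigma : nat -> R) (v : nat -> X) (u : nat -> Y) (alpha gamma : nat -> R)
    (y : Y) (n : nat) : X :=
  if n is m.+1 then
    let x := nsift sigma v u alpha gamma y m in
    xget 0 [set z : X |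
      shifted_pow sigma v (alpha n) (gamma n) z =
        normal_pow_adjoint sigma v u (gamma n) y
        + (shifted_pow sigma v (alpha n) (gamma n) x
           - normal_pow sigma v (gamma n) x)]
  else 0.

Definition nsift_converges (R : realType) (k : scalar_kind)
    (X Y : hilbertType R k) (K : {linear X -> Y}) (sigma : nat -> R)
    (v : nat -> X) (u : nat -> Y) (alpha gamma : nat -> R) : Prop :=
  forall y : Y, range K y ->
    nsift sigma v u alpha gamma y n @[n --> \oo] --> pinv K y.

(* Main.v *)
Require Import Defs.
From mathcomp Require Import all_boot all_order all_algebra.
From mathcomp Require Import all_classical all_reals all_analysis.
From mathcomp Require Import complex.
From HB Require Import structures.
From mathcomp Require Import ring lra.
Import Order.TTheory GRing.Theory Num.Theory.
Import numFieldNormedType.Exports.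
Local Open Scope classical_set_scope.
Local Open Scope ring_scope.

(** The singular system diagonalizes the method.  Let [y = K x] and let
    [c m = inner x (v m)] be the coefficients of [x].  The kernel component of
    [x] is invisible in [y], so the pseudo-inverse of [y] is the orthonormal sum
    of the [c m *: v m] ([pinv_K]).  Write [p n] for the filter factor
    [(s ^+ 2 / (s ^+ 2 + alpha n)) `^ gamma n] at [s = sigma m]; it lies between
    0 and 1, and 1 is excluded.  Along [v m], one step of the iteration
    multiplies the error by [1 - p n].  Hence the error after [n] steps is the
    orthonormal sum with coefficients [e m n * c m], where [e m n] is the product
    of the [1 - p i] for [1 <= i <= n] ([nsift_K], [pinv_sub_nsift]).

    Such a product tends to 0 if and only if the series of the [p i] diverges
    ([prod_1B_cvg0]).  If the series diverges at every singular value, every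
    coefficient of the error tends to 0 while staying dominated by that of the
    pseudo-inverse; by Parseval and dominated convergence of series the error
    tends to 0 in norm ([nsift_cvg_of_error_factor]).  Conversely, the data
    [K (v m)] produce the single error coefficient [e m n]
    ([error_factor_cvg_of_nsift]), so convergence of the method forces
    divergence at [s = sigma m] for every [m].  The filter factors increase with
    [s] and the singular values tend to 0, hence the series diverges at every
    [s > 0].

    Real and complex scalars are treated together.  All estimates are made on
    the real-valued squared modulus [sqmod] and squared norm [sqnorm], so that no
    limit has to be taken in the scalar field. *)

Set Implicit Arguments.
Unset Strict Implicit.
Unset Printing Implicit Defensive.

(** * Infinite products and series of real numbers *)

Section Products.
Variable R : realType.
Implicit Types (p : R ^nat).

Lemma cvg_series_behead p :
  cvgn (series (fun n => p n.+1)) <-> cvgn (series p).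
Proof.
have E : series p \o S = (fun n => p 0 + series (fun i => p i.+1) n).
  by apply/funext => n /=; rewrite !seriesEnat/= big_nat_recl.
split=> [/cvg_ex[l hl]|/cvg_ex[l hl]]; apply/cvg_ex.
- exists (p 0 + l); rewrite -cvg_shiftS [X in X @ _]E.
  by apply: cvgD => //; exact: cvg_cst.
- exists (l - p 0); move: hl; rewrite -cvg_shiftS [X in X @ _]E => hl.
  suff -> : series (fun n => p n.+1)
      = (fun n => (p 0 + series (fun i => p i.+1) n) - p 0).
    by apply: cvgB => //; exact: cvg_cst.
  by apply/funext => n; rewrite addrC addKr.
Qed.

(** The classical bound [1 - t <= exp (- t)], factor by factor: it turns a
    divergent sum into a product that tends to 0. *)
Lemma prod_1B_le_expR p n : (forall i, 0 <= p i <= 1) ->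
  \prod_(i < n) (1 - p i) <= expR (- series p n).
Proof.
move=> hp; rewrite seriesEord/= -sumrN expR_sum.
apply: ler_prod => i _; have /andP[_ h1] := hp i.
by rewrite subr_ge0 h1 expR_ge1Dx.
Qed.

(** The Weierstrass product inequality; it bounds the product away from 0 as
    soon as the sum of the factors' defects is less than 1. *)
Lemma prod_1B_ge_1Bsum p m n : (forall i, 0 <= p i <= 1) ->
  1 - \sum_(m <= i < m + n) p i <= \prod_(m <= i < m + n) (1 - p i).
Proof.
move=> hp; elim: n => [|n IH]; first by rewrite addn0 !big_geq// subr0.
rewrite addnS !big_nat_recr ?leq_addr//=.
have /andP[h0 h1] := hp (m + n)%N.
have S0 : 0 <= \sum_(m <= i < m + n) p i.
  by apply: sumr_ge0 => i _; have /andP[] := hp i.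
have h1' : 0 <= 1 - p (m + n)%N by rewrite subr_ge0.
apply: le_trans (ler_wpM2r h1' IH).
nra.
Qed.

(** If the sum converges, cut it at a rank [N] beyond which its pieces are
    below 1/2: the product over [i >= N] then stays above 1/2, and the finitely
    many factors before [N] are positive because every [p i] is less than 1.
    If the sum diverges, the exponential bound drives the product to 0. *)
Lemma prod_1B_cvg0 p : (forall i, 0 <= p i < 1) ->
  (\prod_(i < n) (1 - p i) @[n --> \oo] --> (0 : R)) <-> ~ cvgn (series p).
Proof.
move=> hp.
have hp' i : 0 <= p i <= 1 by have /andP[-> /ltW ->] := hp i.
have ndS : nondecreasing_seq (series p).
  by apply: nondecreasing_series => n _ _; have /andP[] := hp n.
split=> [P0 Sc|Sd].
- have /cauchy_cvgP/cauchy_seriesP/(_ 2^-1) := Sc.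
  case=> //= -[A B] [[N1 _ hN1] [N2 _ hN2]] hAB.
  pose N := maxn N1 N2.
  have hN n : \sum_(N <= i < N + n) p i < 2^-1.
    have := hAB (N, N + n)%N.
    rewrite /= => /(_ (conj (hN1 _ _) (hN2 _ _))).
    rewrite /= leq_maxl => /(_ isT).
    rewrite (leq_trans (leq_maxr N1 N2) (leq_addr _ _)) => /(_ isT).
    exact/le_lt_trans/ler_norm.
  have hP0 : 0 < \prod_(0 <= i < N) (1 - p i).
    by apply: prodr_gt0 => i _; rewrite subr_gt0; have /andP[] := hp i.
  have /cvgrPdist_lt/(_ (\prod_(0 <= i < N) (1 - p i) / 2)) := P0.
  case; first by rewrite divr_gt0.
  move=> M _ /(_ (N + M)%N (leq_addl _ _)) /=.
  rewrite sub0r normrN -(big_mkord xpredT (fun i => 1 - p i)).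
  rewrite (big_cat_nat (n := N)) ?leq_addr//= ger0_norm; last first.
    rewrite mulr_ge0 ?(ltW hP0)//; apply: prodr_ge0 => i _.
    by rewrite subr_ge0; have /andP[] := hp' i.
  rewrite ltr_pM2l// ltNge => /negP; apply.
  apply: le_trans (prod_1B_ge_1Bsum N M hp').
  by have := hN M; lra.
- apply: (@squeeze_cvgr _ _ _ _ (fun=> 0) (fun n => expR (- series p n))).
  + apply: nearW => n; rewrite prod_1B_le_expR// andbT.
    by apply: prodr_ge0 => i _; rewrite subr_ge0; have /andP[] := hp' i.
  + exact: cvg_cst.
  + exact: (cvg_comp _ _ (nondecreasing_dvgn_lt ndS Sd) (@cvgr_expR R)).
Qed.

Lemma bounded_partial_sums_cvg (a : R ^nat) (M : R) :
  (forall m, 0 <= a m) -> (forall n, series a n <= M) -> cvgn (series a).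
Proof.
move=> a0 hM; apply: nondecreasing_is_cvgn; first exact: nondecreasing_series.
by exists M => _ [n _ <-]; exact: hM.
Qed.

(** Tannery's theorem, that is, dominated convergence for series: the terms
    beyond a fixed rank [M] are controlled by the tail of the dominating
    series, uniformly in [n], and the first [M] terms are a finite sum of
    sequences tending to 0. *)
Lemma tannery (a : R ^nat) (w : nat -> R ^nat) :
  (forall m, 0 <= a m) -> cvgn (series a) ->
  (forall n m, 0 <= w n m <= 1) ->
  (forall m, w n m @[n --> \oo] --> (0 : R)) ->
  limn (series (fun m => w n m * a m)) @[n --> \oo] --> (0 : R).
Proof.
move=> a0 ac w01 w0.
have wa_ge0 n m : 0 <= w n m * a m.
  by rewrite mulr_ge0//; have /andP[] := w01 n m.
have wa_le n m : w n m * a m <= a m.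
  by rewrite ler_piMl//; have /andP[] := w01 n m.
have wac n : cvgn (series (fun m => w n m * a m)) by apply: series_le_cvg ac.
apply/cvgrPdist_lt => e e0.
have e20 : 0 < e / 2 by rewrite divr_gt0.
have [M hM] : exists M, limn (series a) - series a M < e / 2.
  move/cvgrPdist_lt : ac => /(_ _ e20)[M _ /(_ M (leqnn M))] /= h.
  by exists M; exact/le_lt_trans/h/ler_norm.
have : \sum_(m < M) w n m * a m @[n --> \oo] --> \sum_(m < M) 0 * a m.
  apply: (@cvg_big _ _ +%R 0 xpredT) => [|i _]; first exact: add_continuous.
  exact: cvgMr_tmp.
rewrite [X in _ --> X]big1 => [|m _]; last by rewrite mul0r.
move/cvgrPdist_lt => /(_ _ e20); apply: filterS => n.
rewrite !sub0r !normrN ger0_norm ?sumr_ge0// => hn.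
rewrite ger0_norm; last first.
  apply: limr_ge => //; apply: nearW => N; rewrite seriesEord/=.
  exact: sumr_ge0.
suff : limn (series (fun m => w n m * a m)) <= \sum_(m < M) w n m * a m
   + (limn (series a) - series a M).
  by move=> /le_lt_trans; apply; lra.
apply: limr_le => //; exists M => // N /= MN.
rewrite seriesEnat/= (big_cat_nat (n := M))//= big_mkord lerD2l.
apply: (@le_trans _ _ (\sum_(M <= i < N) a i)); first exact: ler_sum.
rewrite -sub_series_geq// lerD2r.
have nda : nondecreasing_seq (series a) by exact: nondecreasing_series.
exact: nondecreasing_cvgn_le nda ac N.
Qed.

End Products.

(** * The two scalar fields *)

Section Scalars.
Variables (R : realType) (k : scalar_kind).
Local Notation F := (scalar_field R k).
Implicit Types (r : R) (a b : F).

Fact of_real_additive : additive (@of_real R k).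
Proof. by case: k => //= x y; rewrite rmorphB. Qed.
Fact of_real_multiplicative : multiplicative (@of_real R k).
Proof. by case: k; split=> //= x y; rewrite rmorphM. Qed.
Fact conj_scalar_additive : additive (@conj_scalar R k).
Proof. by case: k => //= x y; rewrite rmorphB. Qed.
Fact conj_scalar_multiplicative : multiplicative (@conj_scalar R k).
Proof. by case: k; split=> //; [exact: rmorphM|exact: rmorph1]. Qed.

HB.instance Definition _ :=
  GRing.isAdditive.Build R F (@of_real R k) of_real_additive.
HB.instance Definition _ :=
  GRing.isMultiplicative.Build R F (@of_real R k) of_real_multiplicative.
HB.instance Definition _ :=
  GRing.isAdditive.Build F F (@conj_scalar R k) conj_scalar_additive.
HB.instance Definition _ :=
  GRing.isMultiplicative.Build F F (@conj_scalar R k)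
    conj_scalar_multiplicative.

Lemma ler_of_real r s : (of_real r <= of_real s :> F) = (r <= s).
Proof. by case: k => //=; rewrite lecR. Qed.

Lemma ltr_of_real r s : (of_real r < of_real s :> F) = (r < s).
Proof. by case: k => //=; rewrite ltcR. Qed.

Lemma conj_of_real r : conj_scalar (of_real r) = of_real r :> F.
Proof. by case: k => //; exact: conjc_real. Qed.

(** Order and norms take their values in the scalar field; squared moduli and
    squared norms are moved to [R] along this retraction of [of_real], so that
    real analysis applies to both kinds of scalars at once. *)
Definition real_part : F -> R :=
  match k return scalar_field R k -> R with
  | RealScalars => id
  | ComplexScalars => fun z => complex.Re z
  end.

Lemma of_realK : cancel (@of_real R k) real_part.
Proof. by rewrite /real_part; case: k. Qed.

Lemma real_partK a : 0 <= a -> of_real (real_part a) = a.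
Proof.
rewrite /real_part; case: k a => //= a a0.
by rewrite RRe_real// ger0_real.
Qed.

Definition sqmod a : R := real_part (a * conj_scalar a).

Lemma sqmodE a : of_real (sqmod a) = a * conj_scalar a.
Proof.
apply: real_partK; case: k a => /= a; first exact: sqr_ge0.
exact: mulcJ_ge0.
Qed.

Lemma sqmod_ge0 a : 0 <= sqmod a.
Proof.
rewrite -ler_of_real sqmodE rmorph0.
by case: k a => /= a; [exact: sqr_ge0|exact: mulcJ_ge0].
Qed.

Lemma sqmod_of_realM r a : sqmod (of_real r * a) = r ^+ 2 * sqmod a.
Proof.
apply: (can_inj of_realK).
by rewrite expr2 sqmodE !rmorphM/= sqmodE conj_of_real; ring.
Qed.

Lemma sqmod1 : sqmod 1 = 1.
Proof. by apply: (can_inj of_realK); rewrite sqmodE !rmorph1 mulr1. Qed.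

Lemma sqmod0 : sqmod 0 = 0.
Proof. by apply: (can_inj of_realK); rewrite sqmodE !rmorph0 mulr0. Qed.

Lemma conj_scalar_eq0 a : (conj_scalar a == 0) = (a == 0).
Proof. by case: k a => //= a; rewrite conjc_eq0. Qed.

Lemma sqmod_eq0 a : sqmod a = 0 -> a = 0.
Proof.
move=> a0; have := sqmodE a; rewrite a0 rmorph0 => /esym/eqP.
by rewrite mulf_eq0 conj_scalar_eq0 orbb => /eqP.
Qed.

End Scalars.

(** * Inner products and real squared norms *)

Section InnerProduct.
Variables (R : realType) (k : scalar_kind) (H : hilbertType R k).
Implicit Types (x y z : H) (a : scalar_field R k).

Lemma innerDl x y z : inner (x + y) z = inner x z + inner y z.
Proof. by rewrite -{1}[x]scale1r inner_linear_l mul1r. Qed.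

Lemma inner0l z : inner 0 z = 0.
Proof. by apply: (addIr (inner 0 z)); rewrite -innerDl !add0r. Qed.

Lemma innerZl a x z : inner (a *: x) z = a * inner x z.
Proof. by rewrite -[a *: x]addr0 inner_linear_l inner0l addr0. Qed.

Lemma innerBl x y z : inner (x - y) z = inner x z - inner y z.
Proof. by rewrite -scaleN1r innerDl innerZl mulN1r. Qed.

Lemma inner_suml (I : Type) (r : seq I) (f : I -> H) z :
  inner (\sum_(i <- r) f i) z = \sum_(i <- r) inner (f i) z.
Proof.
by elim/big_rec2: _ => [|i y1 y2 _ <-]; rewrite ?inner0l ?innerDl.
Qed.

Lemma innerDr x y z : inner z (x + y) = inner z x + inner z y.
Proof. by rewrite inner_conj innerDl rmorphD/= -!inner_conj. Qed.

Lemma innerZr a x z : inner z (a *: x) = conj_scalar a * inner z x.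
Proof. by rewrite inner_conj innerZl rmorphM/= -inner_conj. Qed.

Lemma inner0r z : inner z 0 = 0.
Proof. by rewrite inner_conj inner0l rmorph0. Qed.

Lemma inner_eq0 x : inner x x = 0 -> x = 0.
Proof. by move/eqP; rewrite inner_norm sqrf_eq0 normr_eq0 => /eqP. Qed.

Definition sqnorm x : R := real_part (inner x x).

Lemma sqnormE x : of_real (sqnorm x) = inner x x.
Proof. by apply: real_partK; rewrite inner_norm exprn_ge0. Qed.

Lemma sqnorm_ge0 x : 0 <= sqnorm x.
Proof. by rewrite -(ler_of_real k) sqnormE rmorph0 inner_norm exprn_ge0. Qed.

Lemma norm_lt_of_real x (e : R) : 0 < e ->
  (`|x| < of_real e) = (sqnorm x < e ^+ 2).
Proof.
move=> e0; rewrite -(ltr_of_real k) sqnormE inner_norm rmorphXn/=.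
rewrite ltr_pXn2r// nnegrE//.
by have := ler_of_real k 0 e; rewrite rmorph0 => ->; exact: ltW.
Qed.

Lemma cvg_sqnorm (f : nat -> H) x :
  f n @[n --> \oo] --> x <-> sqnorm (x - f n) @[n --> \oo] --> (0 : R).
Proof.
split=> [/cvgrPdist_lt fx|/cvgrPdist_lt fx]; apply/cvgrPdist_lt => e e0.
- have s0 : 0 < Num.sqrt e by rewrite sqrtr_gt0.
  have := fx (of_real (Num.sqrt e)).
  have -> : 0 < of_real (Num.sqrt e) :> scalar_field R k.
    by have := ltr_of_real k 0 (Num.sqrt e); rewrite rmorph0 => ->.
  move=> /(_ isT); apply: filterS => n.
  rewrite norm_lt_of_real// sqr_sqrtr ?(ltW e0)//.
  by rewrite sub0r normrN ger0_norm ?sqnorm_ge0.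
- have eE := real_partK (ltW e0).
  have r0 : 0 < real_part e by rewrite -(ltr_of_real k) eE rmorph0.
  have := fx _ (exprn_gt0 2 r0); apply: filterS => n.
  by rewrite sub0r normrN ger0_norm ?sqnorm_ge0// -norm_lt_of_real// eE.
Qed.

Lemma sqnormD_orthogonal x y : inner x y = 0 ->
  sqnorm (x + y) = sqnorm x + sqnorm y.
Proof.
move=> xy0; apply: (can_inj (@of_realK R k)).
rewrite rmorphD/= !sqnormE innerDl !innerDr xy0.
by rewrite (inner_conj x y) xy0 rmorph0 add0r addr0.
Qed.

Lemma sqnormZ a x : sqnorm (a *: x) = sqmod a * sqnorm x.
Proof.
apply: (can_inj (@of_realK R k)).
by rewrite rmorphM/= !sqnormE sqmodE innerZl innerZr mulrA.
Qed.

(** Cauchy-Schwarz: if [z] is nonzero, the orthogonal projection [t *: z] of [x]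
    on the line of [z] has norm at most that of [x], by Pythagoras. *)
Lemma cauchy_schwarz x z : sqmod (inner x z) <= sqnorm x * sqnorm z.
Proof.
have [z0|z0] := eqVneq (sqnorm z) 0.
  have -> : z = 0 by apply: inner_eq0; rewrite -sqnormE z0 rmorph0.
  by rewrite inner0r sqmod0 mulr_ge0 ?sqnorm_ge0.
have zgt0 : 0 < sqnorm z by rewrite lt0r z0 sqnorm_ge0.
pose t := of_real (sqnorm z)^-1 * inner x z.
have tE : t * inner z z = inner x z.
  by rewrite -sqnormE mulrAC -rmorphM/= mulVf// rmorph1 mul1r.
have orth : inner (x - t *: z) (t *: z) = 0.
  by rewrite innerZr innerBl innerZl tE subrr mulr0.
rewrite -ler_pdivrMr//; apply: (@le_trans _ _ (sqnorm (t *: z))).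
  rewrite sqnormZ sqmod_of_realM expr2 -!mulrA [_ * sqnorm z]mulrC mulKf//.
  by rewrite mulrC.
by rewrite -[x in leRHS](subrK (t *: z)) sqnormD_orthogonal// lerDr sqnorm_ge0.
Qed.

(** Continuity of the inner product in its left argument.  Requiring eventually
    constant scalar products keeps the limit in [R]: by Cauchy-Schwarz, their
    squared distance to [inner x z] is bounded by [sqnorm (x - f n)] up to a
    constant factor. *)
Lemma inner_lim (f : nat -> H) x z a : f n @[n --> \oo] --> x ->
  (\forall n \near \oo, inner (f n) z = a) -> inner x z = a.
Proof.
move=> /cvg_sqnorm fx fa; apply/eqP; rewrite -subr_eq0; apply/eqP.
apply: sqmod_eq0; apply/eqP; rewrite eq_le sqmod_ge0 andbT.
have fxz : sqnorm (x - f n) * sqnorm z @[n --> \oo] --> (0 : R).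
  by rewrite -[X in _ --> X](mul0r (sqnorm z)); exact: cvgMr_tmp.
rewrite -[leRHS](cvg_lim (@Rhausdorff R) fxz).
apply: limr_ge; first exact: cvgP fxz.
move: fa; apply: filterS => n <-.
by rewrite -innerBl cauchy_schwarz.
Qed.

End InnerProduct.

(** * Orthonormal series *)

Section OrthonormalSeries.
Variables (R : realType) (k : scalar_kind) (H : hilbertType R k).
Variables (e : nat -> H) (he : orthonormal_seq e).
Local Notation F := (scalar_field R k).
Implicit Types (c d : nat -> F) (x : H).

Definition sqsummable c := cvgn (series (fun m => sqmod (c m))).

Definition oseries c : nat -> H := series (fun m => c m *: e m).
Definition osum c : H := limn (oseries c).

Lemma inner_sum_orthonormal c (r : seq nat) j : uniq r ->
  inner (\sum_(m <- r) c m *: e m) (e j) = if j \in r then c j else 0.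
Proof.
move=> ur; rewrite inner_suml; case: ifPn => jr.
  rewrite (bigD1_seq j)//= innerZl he eqxx mulr1 big1 ?addr0// => i ij.
  by rewrite innerZl he (negbTE ij) mulr0.
rewrite big_seq big1// => i ir; rewrite innerZl he.
by case: eqP => [ij|_]; [rewrite ij (negbTE jr) in ir *|rewrite mulr0].
Qed.

Lemma sqnorm_e j : sqnorm (e j) = 1.
Proof.
apply: (can_inj (@of_realK R k)).
by rewrite sqnormE he eqxx (rmorph1 of_real).
Qed.

Lemma sqnorm_sum_orthonormal c (r : seq nat) : uniq r ->
  sqnorm (\sum_(m <- r) c m *: e m) = \sum_(m <- r) sqmod (c m).
Proof.
elim: r => [|j r IH] /=.
  by rewrite !big_nil /sqnorm inner0l -(rmorph0 (@of_real R k)) of_realK.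
case/andP=> jr ur; rewrite !big_cons addrC sqnormD_orthogonal; last first.
  by rewrite innerZr inner_sum_orthonormal// (negbTE jr) mulr0.
by rewrite IH// sqnormZ sqnorm_e mulr1 addrC.
Qed.

(** The partial Fourier sum [s] is the orthogonal projection of [x] on the span
    of the first [n] vectors; Pythagoras gives the bound. *)
Lemma bessel_inequality x n :
  series (fun m => sqmod (inner x (e m))) n <= sqnorm x.
Proof.
pose s := \sum_(m <- index_iota 0 n) inner x (e m) *: e m.
have dE j : j \in index_iota 0 n -> inner (x - s) (e j) = 0.
  by move=> jn; rewrite innerBl inner_sum_orthonormal ?iota_uniq// jn subrr.
have ds : inner (x - s) s = 0.
  rewrite inner_conj inner_suml big_seq big1 ?rmorph0// => j jn.
  by rewrite innerZl (inner_conj (x - s)) dE// rmorph0 mulr0.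
rewrite seriesEnat/= -sqnorm_sum_orthonormal ?iota_uniq//.
rewrite -{2}[x](subrK s) sqnormD_orthogonal// lerDr.
exact: sqnorm_ge0.
Qed.

Lemma sqsummable_inner x : sqsummable (fun m => inner x (e m)).
Proof.
apply: bounded_partial_sums_cvg (bessel_inequality x) => m; exact: sqmod_ge0.
Qed.

Lemma sqsummableM (f : R ^nat) M c : (forall m, 0 <= f m <= M) ->
  sqsummable c -> sqsummable (fun m => of_real (f m) * c m).
Proof.
move=> fM cs.
have : cvgn (series (fun m => M ^+ 2 * sqmod (c m))).
  exact: (@is_cvg_seriesZ _ _ (M ^+ 2)).
apply: series_le_cvg => m.
- exact: sqmod_ge0.
- by rewrite mulr_ge0 ?sqmod_ge0 ?sqr_ge0.
- rewrite sqmod_of_realM ler_wpM2r ?sqmod_ge0//.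
  have /andP[f0 f1] := fM m.
  by rewrite lerXn2r// nnegrE (le_trans f0 f1).
Qed.

(** By Pythagoras, the squared norm of a block of the orthonormal series is the
    corresponding block of [series (fun m => sqmod (c m))]: both series are
    Cauchy together, and the space is complete. *)
Lemma oseries_cvg_osum c :
  sqsummable c -> oseries c n @[n --> \oo] --> osum c.
Proof.
move/cauchy_cvgP/cauchy_seriesP => cs; apply/cauchy_cvgP/cauchy_seriesP => eps.
move=> eps0; have eE := real_partK (ltW eps0).
have r0 : 0 < real_part eps by rewrite -(ltr_of_real k) eE rmorph0.
have := cs _ (exprn_gt0 2 r0); apply: filterS => n /= hn.
rewrite -eE norm_lt_of_real// sqnorm_sum_orthonormal ?iota_uniq//.
exact: le_lt_trans (ler_norm _) hn.
Qed.

Lemma inner_lim_oseries c x j :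
  oseries c n @[n --> \oo] --> x -> inner x (e j) = c j.
Proof.
move=> cx; apply: (inner_lim cx); exists j.+1 => // n /= jn.
rewrite /oseries seriesEnat/= inner_sum_orthonormal ?iota_uniq//.
by rewrite mem_index_iota jn.
Qed.

Lemma inner_osum c j : sqsummable c -> inner (osum c) (e j) = c j.
Proof. by move=> cs; apply/inner_lim_oseries/oseries_cvg_osum. Qed.

Lemma osum0 : osum (fun=> 0) = 0.
Proof.
apply: cvg_lim; first exact: norm_hausdorff.
rewrite (_ : oseries _ = fun=> 0); first exact: cvg_cst.
apply/funext => n; rewrite /oseries seriesEord/= big1// => i _.
by rewrite scale0r.
Qed.

Lemma osumD c d : sqsummable c -> sqsummable d ->
  osum (fun m => c m + d m) = osum c + osum d.
Proof.
move=> cs ds; apply: cvg_lim; first exact: norm_hausdorff.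
have -> : oseries (fun m => c m + d m) = (fun n => oseries c n + oseries d n).
  apply/funext => n; rewrite /oseries !seriesEord/= -big_split/=.
  by under eq_bigr do rewrite scalerDl.
by apply: cvgD; exact: oseries_cvg_osum.
Qed.

Lemma osumB c d : sqsummable c -> sqsummable d ->
  osum (fun m => c m - d m) = osum c - osum d.
Proof.
move=> cs ds; apply: cvg_lim; first exact: norm_hausdorff.
have -> : oseries (fun m => c m - d m) = (fun n => oseries c n - oseries d n).
  apply/funext => n; rewrite /oseries !seriesEord/= -sumrB.
  by under eq_bigr do rewrite scalerBl.
by apply: cvgB; exact: oseries_cvg_osum.
Qed.

(** The remainder after [n] terms tends to 0 and is orthogonal to the partial
    sum, so the squared norms of the partial sums tend to that of the limit. *)
Lemma parseval c : sqsummable c ->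
  sqnorm (osum c) = limn (series (fun m => sqmod (c m))).
Proof.
move=> cs; apply/esym/cvg_lim => //.
have /cvg_sqnorm h := oseries_cvg_osum cs.
have -> : series (fun m => sqmod (c m))
    = fun n => sqnorm (osum c) - sqnorm (osum c - oseries c n).
  apply/funext => n.
  have dS : inner (osum c - oseries c n) (oseries c n) = 0.
    rewrite {2}/oseries seriesEnat/= inner_conj inner_suml big_seq big1.
      by rewrite rmorph0.
    move=> j jn; rewrite innerZl (inner_conj (_ - _)) innerBl inner_osum//.
    rewrite /oseries seriesEnat/= inner_sum_orthonormal ?iota_uniq// jn.
    by rewrite subrr rmorph0 mulr0.
  rewrite -{1}[osum c](subrK (oseries c n)) (sqnormD_orthogonal dS) addrC addKr.
  by rewrite /oseries !seriesEnat/= sqnorm_sum_orthonormal ?iota_uniq.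
rewrite -[X in _ --> X]subr0; apply: cvgB => //; exact: cvg_cst.
Qed.

End OrthonormalSeries.
Arguments sqsummable_inner {R k H e} he x.

(** * Functional calculus and pseudo-inverse in the singular system *)

Section SpectralCalculus.
Variables (R : realType) (k : scalar_kind) (X : hilbertType R k).
Variables (sigma : nat -> R) (v : nat -> X) (hv : orthonormal_seq v).
Implicit Types (f : R -> R) (d : nat -> scalar_field R k) (x z : X).

Lemma fun_calcE f x :
  fun_calc sigma v f x =
    osum v (fun m => of_real (f (sigma m ^+ 2)) * inner x (v m))
    + of_real (f 0) *: (x - osum v (fun m => inner x (v m))).
Proof. by []. Qed.

(** An orthonormal sum is its own projection on the closed span of the [v m], so
    the term in [f 0] vanishes and only the coefficients are multiplied. *)
Lemma fun_calc_osum f d : sqsummable d ->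
  fun_calc sigma v f (osum v d) =
    osum v (fun m => of_real (f (sigma m ^+ 2)) * d m).
Proof.
move=> ds; have E : (fun m => inner (osum v d) (v m)) = d.
  by apply/funext => m; rewrite inner_osum.
rewrite fun_calcE E subrr scaler0 addr0; congr osum.
by apply/funext => m; rewrite inner_osum.
Qed.

Lemma inner_fun_calc f M x m : (forall i, 0 <= f (sigma i ^+ 2) <= M) ->
  inner (fun_calc sigma v f x) (v m)
  = of_real (f (sigma m ^+ 2)) * inner x (v m).
Proof.
move=> fM; have xs := sqsummable_inner hv x.
rewrite fun_calcE innerDl innerZl innerBl !inner_osum//.
  by rewrite subrr mulr0 addr0.
exact: sqsummableM fM xs.
Qed.

(** The image determines every coefficient of [x], since [f] does not vanish at
    the eigenvalues; the series part being known, the remaining term determines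
    [x] minus its projection, since [f 0] is nonzero. *)
Lemma fun_calc_inj f M : (forall i, 0 < f (sigma i ^+ 2) <= M) -> f 0 != 0 ->
  injective (fun_calc sigma v f).
Proof.
move=> fM f0 x z xz.
have fM' i : 0 <= f (sigma i ^+ 2) <= M.
  by have /andP[/ltW -> ->] := fM i.
have xzE : (fun m => inner x (v m)) = (fun m => inner z (v m)).
  apply/funext => m; have := inner_fun_calc x m fM'.
  rewrite xz (inner_fun_calc _ _ fM') => /mulfI -> //.
  rewrite fmorph_eq0; have /andP[h _] := fM m; exact: lt0r_neq0.
move: xz; rewrite !fun_calcE.
have -> : (fun m => of_real (f (sigma m ^+ 2)) * inner x (v m))
    = (fun m => of_real (f (sigma m ^+ 2)) * inner z (v m)).
  by apply/funext => m; rewrite (congr1 (fun c => c m) xzE).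
rewrite xzE => /addrI /scalerI.
by rewrite fmorph_eq0 => /(_ f0) /addIr.
Qed.

End SpectralCalculus.

Section SingularValueExpansion.
Variables (R : realType) (k : scalar_kind) (X Y : hilbertType R k).
Variables (K : {linear X -> Y}).
Variables (sigma : nat -> R) (v : nat -> X) (u : nat -> Y).
Hypothesis hsve : is_sve K sigma v u.
Implicit Types (x z : X).

Let hv : orthonormal_seq v := sve_orthonormal_r hsve.
Let hu : orthonormal_seq u := sve_orthonormal_l hsve.

Let sve_series x :
  oseries u (fun m => of_real (sigma m) * inner x (v m)) n @[n --> \oo] --> K x
  := @sve_expansion _ _ _ _ _ _ _ _ hsve x.

Lemma inner_K_u x m : inner (K x) (u m) = of_real (sigma m) * inner x (v m).
Proof. exact: (inner_lim_oseries hu m (@sve_series x)). Qed.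

(** The expansion of [K x] depends on the coefficients of [x] only; conversely
    they can be read off [K x], the singular values being nonzero. *)
Lemma K_eq_coef x z :
  (forall m, inner x (v m) = inner z (v m)) <-> K x = K z.
Proof.
split=> [xz|Kxz m]; last first.
  have := inner_K_u x m; rewrite Kxz inner_K_u => /mulfI ->//.
  by rewrite fmorph_eq0 lt0r_neq0// (sve_gt0 hsve).
have := @sve_series z.
rewrite (_ : (fun m => _) = fun m => of_real (sigma m) * inner x (v m)).
  exact: (cvg_unique (@norm_hausdorff _ Y) (@sve_series x)).
by apply/funext => m; rewrite xz.
Qed.

(** For attainable data the pseudo-inverse is the orthogonal projection of [x]
    on the closed span of the right singular vectors: it has the same image as
    [x], and it is orthogonal to the kernel because so is each [v m].  Two
    candidates differ by a vector of the kernel that is orthogonal to it. *)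
Lemma pinv_K x : Defs.pinv K (K x) = osum v (fun m => inner x (v m)).
Proof.
set x' := osum _ _.
have xs := sqsummable_inner hv x.
have Kx' : K x' = K x by apply/K_eq_coef => m; rewrite inner_osum.
have x'_perp z : K z = 0 -> inner x' z = 0.
  move=> Kz0; have zv m : inner z (v m) = 0.
    have /K_eq_coef -> : K z = K 0 by rewrite linear0.
    by rewrite inner0l.
  apply: (inner_lim (oseries_cvg_osum hv xs)); apply: nearW => n.
  rewrite /oseries seriesEord/= inner_suml big1// => i _.
  by rewrite innerZl (inner_conj z) zv rmorph0 mulr0.
apply: xget_subset1.
  by split=> // z; rewrite Kx' subrr inner0l.
move=> a b [a_perp Ka] [b_perp Kb].
have KE c : (forall z, inner (K x - K c) (K z) = 0) -> K c = K x.
  move=> h; have := h (x - c); rewrite linearB => /inner_eq0/eqP.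
  by rewrite subr_eq0 => /eqP.
have Kab : K (a - b) = 0 by rewrite linearB/= (KE a)// (KE b)// subrr.
apply/eqP; rewrite -subr_eq0; apply/eqP/inner_eq0.
by rewrite innerBl a_perp// b_perp// subrr.
Qed.

End SingularValueExpansion.

(** * The iteration, coefficient by coefficient *)

Section Iteration.
Variables (R : realType) (k : scalar_kind) (X Y : hilbertType R k).
Variables (K : {linear X -> Y}).
Variables (sigma : nat -> R) (v : nat -> X) (u : nat -> Y).
Hypothesis hsve : is_sve K sigma v u.
Variables (alpha gamma : nat -> R).
Hypotheses (halpha : forall n, 0 < alpha n) (hgamma : forall n, 0 < gamma n).

Implicit Types (s g a : R) (n : nat) (x : X).

Let hv : orthonormal_seq v := sve_orthonormal_r hsve.
Let sigma_gt0 : forall m, 0 < sigma m := sve_gt0 hsve.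

Definition filter_factor (s : R) n := (s ^+ 2 / (s ^+ 2 + alpha n)) `^ gamma n.

Lemma filter_factor_itv s n : 0 < s -> 0 <= filter_factor s n < 1.
Proof.
move=> s0; rewrite powR_ge0/=.
have s20 : 0 < s ^+ 2 by rewrite exprn_gt0.
have sa0 : 0 < s ^+ 2 + alpha n by rewrite addr_gt0.
have -> : 1 = (1 : R) `^ gamma n by rewrite powR1.
apply: gt0_ltr_powR => //.
- by rewrite nnegrE divr_ge0// ltW.
- by rewrite nnegrE.
- by rewrite ltr_pdivrMr// mul1r ltrDl.
Qed.

(** The first step of the iteration uses the parameters of index 1, whence the
    shift of the index. *)
Definition error_factor s n := \prod_(i < n) (1 - filter_factor s i.+1).

Lemma error_factor_itv s n : 0 < s -> 0 <= error_factor s n <= 1.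
Proof.
move=> s0; have h i : 0 <= 1 - filter_factor s i.+1 <= 1.
  have /andP[f0 /ltW f1] := filter_factor_itv i.+1 s0.
  by rewrite subr_ge0 f1 gerBl.
rewrite prodr_ge0 => [|i _]; last by have /andP[] := h i.
by apply: prodr_ile1 => i _; exact: h.
Qed.

Lemma error_factor_cvg0 s : 0 < s ->
  (error_factor s n @[n --> \oo] --> (0 : R)) <->
  ~ cvgn (series (filter_factor s)).
Proof.
move=> s0.
have := cvg_series_behead (filter_factor s).
have := @prod_1B_cvg0 R (fun n => filter_factor s n.+1)
   (fun i => filter_factor_itv i.+1 s0).
move=> h1 h2; split=> [/h1 h /h2//|h]; apply/h1 => /h2; exact: h.
Qed.

Lemma powR_sqr_split s g : 0 < s -> s `^ (2 * g - 1) * s = (s ^+ 2) `^ g.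
Proof.
move=> s0; rewrite -{2}[s]powRr1 ?(ltW s0)// -powRD ?(gt_eqF s0) ?implybT//.
by rewrite subrK powRrM -[in RHS]powR_mulrn ?(ltW s0).
Qed.

(** The equation of one step of the method along a single singular vector: with
    [p] the filter factor, [1 - e_n] solves it when [e_n = (1 - p) e_(n-1)]. *)
Lemma error_factor_recursion s n : 0 < s ->
  (s ^+ 2 + alpha n.+1) `^ gamma n.+1 * (1 - error_factor s n.+1)
  = (s ^+ 2) `^ gamma n.+1
    + ((s ^+ 2 + alpha n.+1) `^ gamma n.+1 * (1 - error_factor s n)
       - (s ^+ 2) `^ gamma n.+1 * (1 - error_factor s n)).
Proof.
move=> s0; have s20 : 0 < s ^+ 2 by rewrite exprn_gt0.
have sa0 : 0 < s ^+ 2 + alpha n.+1 by rewrite addr_gt0.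
rewrite /error_factor big_ord_recr/= -/(error_factor s n) /filter_factor.
rewrite powRM ?invr_ge0 ?(ltW s20) ?(ltW sa0)//.
rewrite -(powR_inv1 (ltW sa0)) powRAC powR_inv1 ?powR_ge0//.
by field; rewrite gt_eqF// powR_gt0.
Qed.

Lemma sqsummable_error_factor n x :
  sqsummable (fun m => of_real (error_factor (sigma m) n) * inner x (v m)).
Proof.
apply: (@sqsummableM _ _ _ 1) => [m|]; first exact: error_factor_itv.
exact: sqsummable_inner.
Qed.

Lemma sqsummable_iterate n x :
  sqsummable (fun m => of_real (1 - error_factor (sigma m) n) * inner x (v m)).
Proof.
apply: (@sqsummableM _ _ _ 1) => [m|]; last exact: sqsummable_inner.
by have /andP[h0 h1] := error_factor_itv n (sigma_gt0 m);
  rewrite subr_ge0 h1 gerBl.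
Qed.

(** The eigenvalues are bounded by [sigma 0 ^+ 2], so the powers are bounded on
    them and act on square-summable coefficients. *)
Lemma sigma_shift_powR_bounds a g m : 0 <= a -> 0 <= g ->
  0 < (sigma m ^+ 2 + a) `^ g <= (sigma 0 ^+ 2 + a) `^ g.
Proof.
move=> a0 g0; have sa i : 0 < sigma i ^+ 2 + a.
  by rewrite ltr_pwDl// exprn_gt0.
rewrite powR_gt0//=; apply: ge0_ler_powR => //; rewrite ?nnegrE ?(ltW (sa _))//.
rewrite lerD2r lerXn2r ?nnegrE ?(ltW (sigma_gt0 _))//.
exact: (sve_nonincreasing hsve).
Qed.

(** Each iterate is the only solution of its defining equation, the shifted
    power being injective; it thus suffices that the announced orthonormal sum
    is a solution, which is checked on coefficients. *)
Lemma nsift_K x n :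
  nsift sigma v u alpha gamma (K x) n =
  osum v (fun m => of_real (1 - error_factor (sigma m) n) * inner x (v m)).
Proof.
elim: n => [|n IH].
  rewrite (_ : (fun m => _) = fun=> 0) ?osum0//.
  by apply/funext => m; rewrite /error_factor big_ord0 subrr rmorph0 mul0r.
rewrite /= IH; set a := alpha n.+1; set g := gamma n.+1.
have a0 : 0 < a by exact: halpha.
have g0 : 0 < g by exact: hgamma.
pose d j m := of_real (1 - error_factor (sigma m) j) * inner x (v m).
have ds j : sqsummable (d j) by exact: sqsummable_iterate.
have bs m := sigma_shift_powR_bounds m (ltW a0) (ltW g0).
have bs' m : 0 <= (sigma m ^+ 2 + a) `^ g <= (sigma 0 ^+ 2 + a) `^ g.
  by have /andP[/ltW -> ->] := bs m.
have bn m : 0 <= (sigma m ^+ 2) `^ g <= (sigma 0 ^+ 2) `^ g.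
  have := sigma_shift_powR_bounds m (lexx 0) (ltW g0); rewrite !addr0.
  by case/andP => /ltW -> ->.
have solves : shifted_pow sigma v a g (osum v (d n.+1)) =
    normal_pow_adjoint sigma v u g (K x)
    + (shifted_pow sigma v a g (osum v (d n))
       - normal_pow sigma v g (osum v (d n))).
  rewrite /shifted_pow /normal_pow !fun_calc_osum//.
  have -> : normal_pow_adjoint sigma v u g (K x)
      = osum v (fun m => of_real ((sigma m ^+ 2) `^ g) * inner x (v m)).
    congr osum; apply/funext => m.
    by rewrite (inner_K_u hsve) mulrA -rmorphM/= powR_sqr_split.
  have fs := sqsummableM bs' (ds n); have qs := sqsummableM bn (ds n).
  have ys := sqsummableM bn (sqsummable_inner hv x).
  have fs' := sqsummableM bs' (ds n.+1).
  have move_term (L A B C : X) : L + C = A + B -> L = A + (B - C).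
    by move=> LC; rewrite addrA -LC addrK.
  apply: move_term; rewrite -(osumD hv fs' qs) -(osumD hv ys fs).
  congr osum; apply/funext => m; rewrite /d !mulrA -!rmorphM/= -!mulrDl.
  by rewrite -!rmorphD/= error_factor_recursion// -addrA subrK.
apply: xget_subset1 => // z1 z2 z1E z2E.
apply: (@fun_calc_inj _ _ _ sigma v hv (fun t => (t + a) `^ g) _ bs).
  by rewrite add0r gt_eqF// powR_gt0.
exact: etrans z1E (esym z2E).
Qed.

Lemma pinv_sub_nsift x n :
  Defs.pinv K (K x) - nsift sigma v u alpha gamma (K x) n =
  osum v (fun m => of_real (error_factor (sigma m) n) * inner x (v m)).
Proof.
rewrite (pinv_K hsve) nsift_K.
rewrite -(osumB hv (sqsummable_inner hv x) (@sqsummable_iterate n x)).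
congr osum; apply/funext => m.
by rewrite rmorphB/= (rmorph1 of_real) mulrBl mul1r opprB addrC subrK.
Qed.

(** By Parseval the squared error is a series dominated by the convergent
    series of the squared coefficients of [x]. *)
Lemma nsift_cvg_of_error_factor x :
  (forall m, error_factor (sigma m) n @[n --> \oo] --> (0 : R)) ->
  nsift sigma v u alpha gamma (K x) n @[n --> \oo] --> Defs.pinv K (K x).
Proof.
move=> ef0; apply/cvg_sqnorm.
rewrite (_ : (fun n => _) = fun n => limn (series (fun m =>
    error_factor (sigma m) n ^+ 2 * sqmod (inner x (v m))))); last first.
  apply/funext => n; rewrite pinv_sub_nsift.
  rewrite (parseval hv (@sqsummable_error_factor n x)).
  by congr (limn (series _)); apply/funext => m; rewrite sqmod_of_realM.
apply: tannery => [m||n m|m].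
- exact: sqmod_ge0.
- exact: sqsummable_inner.
- have /andP[h0 h1] := error_factor_itv n (sigma_gt0 m).
  by rewrite exprn_ge0//= exprn_ile1.
- rewrite -[X in _ --> X](mul0r 0); exact: cvgM.
Qed.

(** For the data [K (v m)] the error is a multiple of [v m], so the error
    factor is recovered as its coefficient along [v m]. *)
Lemma error_factor_cvg_of_nsift m :
  nsift sigma v u alpha gamma (K (v m)) n @[n --> \oo]
    --> Defs.pinv K (K (v m)) ->
  error_factor (sigma m) n @[n --> \oo] --> (0 : R).
Proof.
move=> /cvg_sqnorm hc.
apply: (@squeeze_cvgr _ _ _ _ (fun=> 0) (fun n => Num.sqrt (sqnorm
  (Defs.pinv K (K (v m)) - nsift sigma v u alpha gamma (K (v m)) n)))).
- apply: nearW => n; have /andP[e0 _] := error_factor_itv n (sigma_gt0 m).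
  rewrite e0/= pinv_sub_nsift.
  rewrite -[leLHS](ger0_norm e0) -sqrtr_sqr ler_wsqrtr//.
  apply: le_trans (_ : _ <= sqnorm _ * sqnorm (v m)) _; last first.
    by rewrite (sqnorm_e hv) mulr1.
  apply: le_trans (cauchy_schwarz _ _).
  rewrite (inner_osum hv m (@sqsummable_error_factor n (v m))) hv eqxx.
  by rewrite sqmod_of_realM sqmod1 mulr1.
- exact: cvg_cst.
- rewrite -[X in _ --> X]sqrtr0.
  exact: (cvg_comp _ _ hc (@sqrt_continuous R 0)).
Qed.

Lemma filter_factor_le s t n : 0 < s -> s <= t ->
  filter_factor s n <= filter_factor t n.
Proof.
move=> s0 st; have t0 := lt_le_trans s0 st.
have s2 : 0 < s ^+ 2 by rewrite exprn_gt0.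
have t2 : 0 < t ^+ 2 by rewrite exprn_gt0.
have st2 : s ^+ 2 <= t ^+ 2 by rewrite lerXn2r// nnegrE ltW.
have a0 := halpha n.
have sa : 0 < s ^+ 2 + alpha n by rewrite addr_gt0.
have ta : 0 < t ^+ 2 + alpha n by rewrite addr_gt0.
apply: ge0_ler_powR; [exact: ltW|by rewrite nnegrE divr_ge0// ltW..|].
rewrite ler_pdivrMr// mulrAC ler_pdivlMr// !mulrDr mulrC lerD2l.
by rewrite ler_pM2r.
Qed.

End Iteration.

Theorem theorem32 (R : realType) (k : scalar_kind) (X Y : hilbertType R k)
    (K : {linear X -> Y}) (hK : compact_operator K)
    (hrange : infinite_dim_range K)
    (sigma : nat -> R) (v : nat -> X) (u : nat -> Y)
    (hsve : is_sve K sigma v u)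
    (alpha gamma : nat -> R)
    (halpha : forall n, 0 < alpha n) (hgamma : forall n, 1 / 2 <= gamma n) :
  nsift_converges K sigma v u alpha gamma <->
  (forall s : R, 0 < s ->
     ~ cvgn (series (fun n => (s ^+ 2 / (s ^+ 2 + alpha n)) `^ gamma n))).
Proof.
have gamma_gt0 n : 0 < gamma n by apply: lt_le_trans (hgamma n); lra.
have sigma_gt0 := sve_gt0 hsve.
(* The filter factors increase with [s], so divergence at some singular value
   below [s] suffices. *)
split=> [conv s s0|div y [x _ <-]].
  have [m ms] : exists m, sigma m <= s.
    have /cvgrPdist_lt/(_ s s0)[m _ /(_ m (leqnn m))] := sve_cvg0 hsve.
    rewrite /= sub0r normrN => h; exists m.
    exact: ltW (le_lt_trans (ler_norm _) h).
  have /(error_factor_cvg_of_nsift hsve halpha gamma_gt0) :=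
    conv (K (v m)) (ex_intro2 _ _ (v m) I erefl).
  move=> /(error_factor_cvg0 halpha gamma_gt0 (sigma_gt0 m)) h sc; apply: h.
  apply: series_le_cvg sc => n; rewrite ?powR_ge0//.
  exact: filter_factor_le.
apply: nsift_cvg_of_error_factor => // m.
by apply/error_factor_cvg0 => //; exact: div.
Qed.
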